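(* For all rays $a,b,c$ such that the ray $b$ lies between the rays $a$ and $c$: (a) $a,b$ are divergent, $b,c$ are divergent, and $a,c$ are divergent; (b) the ray $b$ lies between the rays $c$ and $a$; (c) the ray $a$ does not lie between $b$ and $c$, and the ray $c$ does not lie between $a$ and $b$.
   Context: Synthetic plane geometry with classical logic. Primitive notions: points, lines (with equality), incidence $A\in x$, a ternary betweenness relation $\mathrm{Bet}(A,B,C)$ (''$B$ strictly between $A$ and $C$''), lengths with a map $(A,B)\mapsto|AB|$. Points are collinear if some line contains all of them. Axioms: (incidence) there is a point; for every point there is a distinct point; every line has a point; for every line $x$ and $A\in x$ there is $B\in x$, $B\neq A$; for every line there is a point not on it; through two distinct points there is a line; if $A\neq B$, $A,B\in x$ and $x\neq y$ then $A\notin y$ or $B\notin y$. (betweenness) if $\mathrm{Bet}(A,B,C)$ then $A\neq C$, $A,B,C$ collinear, $\mathrm{Bet}(C,B,A)$, and not $\mathrm{Bet}(B,A,C)$. (lengths) $|AB|=|CC|$ iff $A=B$; $|AB|=|BA|$. (line–circle) for $O,A,B$ with $A\neq O$ there is $C$ with ($\mathrm{Bet}(A,O,C)$ or $O=C$) and $|OB|=|OC|$. ''$P,Q$ on opposite sides of line $x$'': $P,Q\notin x$ and some $O\in x$ has $\mathrm{Bet}(P,O,Q)$; ''same side of $x$'': $P,Q\notin x$ and no such $O$ exists. (Pasch) if $P,Q$ are on opposite sides of $x$ and $R\notin x$, then $P,R$ or $R,Q$ are on opposite sides of $x$. A ray is an ordered pair $a=(a_0,a_1)$ of distinct points; $\ell_a$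 denotes the line through $a_0,a_1$. Rays $a,b$ are divergent iff $a_0=b_0$ and $a_0,a_1,b_1$ are not collinear. Rays $b,c$ lie on the same side of ray $a$ iff $a_0=b_0=c_0$ and $b_1,c_1$ lie on the same side of $\ell_a$. The ray $b$ lies between the rays $a$ and $c$ iff $b,c$ lie on the same side of $a$ and $b,a$ lie on the same side of $c$. *)

(* Defs.v *)
From Stdlib Require Import Classical ClassicalEpsilon.

Set Implicit Arguments.
Unset Strict Implicit.

(** Primitive notions.  Points, lines and lengths are compared with Leibniz
    equality. *)
Record geometry := Geometry {
  point : Type;
  line : Type;
  length : Type;
  incident : point -> line -> Prop;
  Bet : point -> point -> point -> Prop;  (* [Bet A B C]: the middle one is [B] *)
  dist : point -> point -> length
}.

Arguments incident {g} A x.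
Arguments Bet {g} A B C.
Arguments dist {g} A B.

Section Sides.
Variable G : geometry.
Implicit Types (A B C P Q : point G) (x : line G).

Definition collinear A B C : Prop :=
  exists x, incident A x /\ incident B x /\ incident C x.

Definition opposite_sides x P Q : Prop :=
  ~ incident P x /\ ~ incident Q x /\ exists O, incident O x /\ Bet P O Q.

Definition same_side x P Q : Prop :=
  ~ incident P x /\ ~ incident Q x /\ ~ (exists O, incident O x /\ Bet P O Q).

End Sides.

Record plane := Plane {
  plane_geometry :> geometry;

  point_exists : exists A : point plane_geometry, True;
  point_distinct : forall A : point plane_geometry, exists B, B <> A;
  line_point : forall x : line plane_geometry, exists A, incident A x;
  line_second_point : forall (x : line plane_geometry) A,
    incident A x -> exists B, incident B x /\ B <> A;
  point_off_line : forall x : line plane_geometry, exists A, ~ incident A x;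
  line_through : forall A B : point plane_geometry,
    A <> B -> exists x, incident A x /\ incident B x;
  lines_meet_once : forall (A B : point plane_geometry) x y,
    A <> B -> incident A x -> incident B x -> x <> y ->
    ~ incident A y \/ ~ incident B y;

  Bet_neq : forall A B C : point plane_geometry, Bet A B C -> A <> C;
  Bet_collinear : forall A B C : point plane_geometry,
    Bet A B C -> collinear A B C;
  Bet_sym : forall A B C : point plane_geometry, Bet A B C -> Bet C B A;
  Bet_asym : forall A B C : point plane_geometry, Bet A B C -> ~ Bet B A C;

  dist_zero : forall A B C : point plane_geometry,
    dist A B = dist C C <-> A = B;
  dist_sym : forall A B : point plane_geometry, dist A B = dist B A;

  line_circle : forall O A B : point plane_geometry,
    A <> O -> exists C, (Bet A O C \/ O = C) /\ dist O B = dist O C;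

  Pasch : forall (x : line plane_geometry) P Q R,
    opposite_sides x P Q -> ~ incident R x ->
    opposite_sides x P R \/ opposite_sides x R Q
}.

Record ray (G : geometry) := Ray {
  ray0 : point G;
  ray1 : point G;
  ray_neq : ray0 <> ray1
}.

Arguments ray_neq {G} r _.

Section Rays.
Variable G : plane.
Implicit Types a b c : ray G.

Lemma ray_line_exists a :
  exists x : line G, incident (ray0 a) x /\ incident (ray1 a) x.
Proof. exact (line_through (ray_neq a)). Qed.

Definition ray_line a : line G :=
  proj1_sig (constructive_indefinite_description _ (ray_line_exists a)).

Lemma ray_line_spec a :
  incident (ray0 a) (ray_line a) /\ incident (ray1 a) (ray_line a).
Proof.
exact (proj2_sig (constructive_indefinite_description _ (ray_line_exists a))).
Qed.

Lemma ray_line_unique a (x : line G) :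
  incident (ray0 a) x -> incident (ray1 a) x -> x = ray_line a.
Proof.
intros H0 H1; apply NNPP; intros Hx.
destruct (ray_line_spec a) as [K0 K1].
destruct (lines_meet_once (ray_neq a) H0 H1 Hx); contradiction.
Qed.

Definition divergent a b : Prop :=
  ray0 a = ray0 b /\ ~ collinear (ray0 a) (ray1 a) (ray1 b).

Definition ray_same_side a b c : Prop :=
  ray0 a = ray0 b /\ ray0 b = ray0 c /\
  same_side (ray_line a) (ray1 b) (ray1 c).

(** [ray_between a b c]: the ray [b], in the middle as for [Bet], lies between
    [a] and [c]. *)
Definition ray_between a b c : Prop :=
  ray_same_side a b c /\ ray_same_side c b a.

End Rays.

(* Main.v *)
Require Import Defs.
From Stdlib Require Import Classical.

(** For (c): were [b] between [a] and [c] while [a] is between [b] and [c] (or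
    [c] between [a] and [b]), then, with [O] the common origin and [A], [B], [C]
    the second points of the rays, every two of [A], [B], [C] would lie on the
    same side of the line joining [O] to the third.  Prolong [AO] beyond [O] to
    [A'].  The segment [A'C] crosses [OB] at some [X], which lies on the side of
    [C], hence of [B], with respect to [OA].  But [A'], and with it [X], is
    separated from [B] by [OC], and [XB] can only meet [OC] at [O], so [O] lies
    between [X] and [B], which puts them on opposite sides of [OA]. *)

Section Plane.
Variable G : plane.
Implicit Types (A B C O P Q R X : point G) (x y z : line G) (a b c : ray G).

Lemma line_unique A B x y :
  A <> B -> incident A x -> incident B x -> incident A y -> incident B y ->
  x = y.
Proof.
intros nAB Ax Bx Ay By; apply NNPP; intros nxy.
destruct (lines_meet_once nAB Ax Bx nxy); contradiction.
Qed.

Lemma point_unique P Q x y :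
  x <> y -> incident P x -> incident P y -> incident Q x -> incident Q y ->
  P = Q.
Proof.
intros nxy Px Py Qx Qy; apply NNPP; intros nPQ.
exact (nxy (line_unique P Q x y nPQ Px Qx Py Qy)).
Qed.

Lemma Bet_neq_left A B C : Bet A B C -> A <> B.
Proof. intros H <-; exact (Bet_asym H H). Qed.

Lemma Bet_incident A B C x :
  Bet A B C -> incident A x -> incident C x -> incident B x.
Proof.
intros H Ax Cx; destruct (Bet_collinear H) as (y & Ay & By & Cy).
now rewrite (line_unique A C x y (Bet_neq H) Ax Cx Ay Cy).
Qed.

Lemma Bet_incident_right A B C x :
  Bet A B C -> incident A x -> incident B x -> incident C x.
Proof.
intros H Ax Bx; destruct (Bet_collinear H) as (y & Ay & By & Cy).
now rewrite (line_unique A B x y (Bet_neq_left A B C H) Ax Bx Ay By).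
Qed.

Lemma opposite_sides_sym x P Q : opposite_sides x P Q -> opposite_sides x Q P.
Proof.
intros (nP & nQ & O & Ox & H); repeat split; trivial.
exists O; split; [trivial | exact (Bet_sym H)].
Qed.

Lemma same_side_sym x P Q : same_side x P Q -> same_side x Q P.
Proof.
intros (nP & nQ & H); repeat split; trivial.
intros (O & Ox & K); apply H; exists O; split; [trivial | exact (Bet_sym K)].
Qed.

Lemma same_side_not_opposite x P Q : same_side x P Q -> ~ opposite_sides x P Q.
Proof. intros (_ & _ & H) (_ & _ & K); exact (H K). Qed.

(** By Pasch, [x] separates [R] from [P] or from [Q], and the second is excluded. *)
Lemma opposite_same_side x P Q R :
  opposite_sides x P Q -> same_side x Q R -> opposite_sides x P R.
Proof.
intros H K; destruct (Pasch H (proj1 (proj2 K))) as [|L]; trivial.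
now destruct (same_side_not_opposite x Q R K); apply opposite_sides_sym.
Qed.

(** If [x] separated [P] from [R], Pasch would make it separate [Q] from one of them. *)
Lemma same_side_trans x P Q R :
  same_side x P Q -> same_side x Q R -> same_side x P R.
Proof.
intros H K; destruct H as (nP & nQ & H), K as (nQ' & nR & K).
repeat split; trivial; intros L.
destruct (Pasch (conj nP (conj nR L)) nQ) as [(_ & _ & M) | (_ & _ & M)]; auto.
Qed.

Lemma Bet_opposite_sides x P O Q :
  Bet P O Q -> incident O x -> ~ incident P x -> opposite_sides x P Q.
Proof.
intros H Ox nP; repeat split; trivial.
- intros Qx; apply nP; exact (Bet_incident_right Q O P x (Bet_sym H) Qx Ox).
- now exists O.
Qed.

(** The line [PQ] meets [x] only at [P], so a crossing between [X] and [Q] would be [P] itself,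
    against the asymmetry of [Bet]. *)
Lemma Bet_same_side x P X Q :
  Bet P X Q -> incident P x -> ~ incident Q x -> same_side x X Q.
Proof.
intros H Px nQ; repeat split; trivial.
- intros Xx; exact (nQ (Bet_incident_right P X Q x H Px Xx)).
- intros (O & Ox & K); destruct (Bet_collinear H) as (y & Py & Xy & Qy).
  assert (nxy : x <> y) by (intros ->; contradiction).
  assert (Oy := Bet_incident X O Q y K Xy Qy).
  rewrite (point_unique O P x y nxy Ox Oy Px Py) in K.
  exact (Bet_asym H K).
Qed.

Lemma Bet_extend A O : A <> O -> exists A', Bet A O A'.
Proof.
(* The circle about [O] goes through [A] itself; the degenerate case [O = C] would give it radius
   zero and force [A = O]. *)
intros nAO; destruct (line_circle A nAO) as (C & [H | <-] & K).
- now exists C.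
- apply dist_zero in K; now destruct nAO.
Qed.

(** The contradiction behind (c), with [x], [y], [z] as the lines [OA], [OB], [OC]. *)
Lemma no_three_same_sides O A B C x y z :
  incident O x -> incident O y -> incident O z ->
  incident A x -> incident B y -> incident C z ->
  same_side x B C -> same_side y A C -> same_side z A B -> False.
Proof.
intros Ox Oy Oz Ax By Cz HBC HAC HAB.
assert (nAO : A <> O) by (intros ->; exact (proj1 HAC Oy)).
destruct (Bet_extend A O nAO) as (A' & HA').
assert (A'x := Bet_incident_right A O A' x HA' Ax Ox).
assert (A'C : opposite_sides y A' C).
{ apply opposite_same_side with A; trivial.
  apply opposite_sides_sym, Bet_opposite_sides with O; trivial.
  exact (proj1 HAC). }
assert (A'B : opposite_sides z A' B).
{ apply opposite_same_side with A; trivial.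
  apply opposite_sides_sym, Bet_opposite_sides with O; trivial.
  exact (proj1 HAB). }
destruct A'C as (_ & _ & X & Xy & HX).
assert (XB : same_side x X B).
{ apply same_side_trans with C; [|now apply same_side_sym].
  apply Bet_same_side with A'; trivial; exact (proj1 (proj2 HBC)). }
assert (XA' : same_side z X A').
{ apply Bet_same_side with C; trivial; [exact (Bet_sym HX) | exact (proj1 A'B)]. }
assert (BX : opposite_sides z B X).
{ apply opposite_same_side with A'.
  - now apply opposite_sides_sym.
  - now apply same_side_sym. }
destruct BX as (nBz & _ & P & Pz & HP).
(* The crossing [P] of [BX] with [z] lies on [y] too, so it is [O]. *)
assert (Py := Bet_incident B P X y HP By Xy).
assert (nyz : y <> z) by (intros ->; contradiction).
rewrite (point_unique P O y z nyz Py Pz Oy Oz) in HP.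
apply (proj2 (proj2 XB)); exists O; split; [trivial | exact (Bet_sym HP)].
Qed.

Lemma ray_same_side_sym a b c : ray_same_side a b c -> ray_same_side a c b.
Proof.
intros (ab & bc & H); split; [congruence | split; [congruence|]].
now apply same_side_sym.
Qed.

Lemma no_three_ray_same_sides a b c :
  ray_same_side a b c -> ray_same_side b a c -> ray_same_side c a b -> False.
Proof.
intros (ab & bc & Ha) (_ & _ & Hb) (_ & _ & Hc).
destruct (ray_line_spec a) as [a0 a1], (ray_line_spec b) as [b0 b1],
  (ray_line_spec c) as [c0 c1].
(* The three origins are all replaced by [ray0 a]. *)
rewrite <- bc, <- ab in c0; rewrite <- ab in b0.
exact (no_three_same_sides _ _ _ _ _ _ _ a0 b0 c0 a1 b1 c1 Ha Hb Hc).
Qed.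

Lemma divergent_off_line a b :
  ray0 a = ray0 b -> ~ incident (ray1 b) (ray_line a) -> divergent a b.
Proof.
intros ab nb; split; trivial; intros (x & x0 & x1 & xb).
now rewrite (ray_line_unique x0 x1) in xb.
Qed.

Lemma divergent_sym a b : divergent a b -> divergent b a.
Proof.
intros (ab & H); split; [congruence | intros (x & x0 & x1 & xa)].
apply H; exists x; rewrite ab; auto.
Qed.

End Plane.

Theorem theorem11 : forall (G : plane) (a b c : ray G),
  ray_between a b c ->
  (divergent a b /\ divergent b c /\ divergent a c) /\
  ray_between c b a /\
  (~ ray_between b a c /\ ~ ray_between a c b).
Proof.
intros G a b c [Ha Hc]; split; [|split; [now split | split]].
(* Divergence comes from the second points of [b] and [a] being off the lines of the outer rays. *)
- destruct Ha as (ab & bc & nB & _), Hc as (cb & ba & nB' & nA & _).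
  split; [|split].
  + now apply divergent_off_line.
  + now apply divergent_sym, divergent_off_line.
  + apply divergent_sym, divergent_off_line; [congruence | trivial].
(* [Hb] supplies the missing third condition: [a] and [c] on the same side of [b]. *)
- intros [Hb _].
  exact (no_three_ray_same_sides G a b c Ha Hb (ray_same_side_sym G c b a Hc)).
- intros [_ Hb].
  exact (no_three_ray_same_sides G a b c Ha (ray_same_side_sym G b c a Hb)
    (ray_same_side_sym G c b a Hc)).
Qed.
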